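(* There is an absolute constant $c>0$ such that the following holds. Let $\mathcal{F}=\mathrm{ReLU}(L,\mathbf{d},\boldsymbol{\omega})$ with $d_i\geq2$ and $\omega_i\geq2$. Suppose $\ell$ is a Lipschitz loss function having range $[0,H]$. Denote by $N$ the number of parameters in the network, $\alpha=\min\big\{H,\,\|\ell\|_{\mathrm{Lip}}\sqrt{d_L}\prod_{i=1}^L\omega_i\big\}$, and $\beta=\alpha^{-1}\|\ell\|_{\mathrm{Lip}}\sqrt{d_L}\prod_{i=1}^L\omega_i$. Then $$\sup_{X\in\mathbb{R}^{d_0\times n},\ \|X\|_{\max}\leq1}\mathfrak{R}_S(\mathcal{F};\ell)\;\leq\; c\,\alpha\sqrt{N/n}\cdot\left(\log\beta+\log n+\sum_{i=1}^L\log d_i+L\log_+\log_+\big(\beta\sqrt{n/d_L}\big)\right)^{1/2},$$ where $\log_+(x)=\max\{0,\log(x)\}$. In particular, if $d_i=d$ and $\omega_i=\omega$ for all $i$, the loss function is such that $\|\ell\|_{\mathrm{Lip}}$ and $H$ are $\mathcal{O}(1)$ constants, and the data size satisfies $\log n=\mathcal{O}(L\log(dL))$, then $$\sup_{X\in\mathbb{R}^{d\times n},\ \|X\|_{\max}\leq1}\mathfrak{R}_S(\mathcal{F};\ell)=\mathcal{O}\left(n^{-1/2}\cdot dL\sqrt{\log(dL\omega)}\right).$$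
   Context: $\mathrm{ReLU}(L,\mathbf{d},\boldsymbol{\omega})$, with $\mathbf{d}=(d_0,\dots,d_L)$ and $\boldsymbol{\omega}=(\omega_1,\dots,\omega_L)$, is the class of fully connected networks $f(x)=\mathrm{ReLU}\big[A_L(\cdots\mathrm{ReLU}(A_1x+b_1)\cdots)+b_L\big]$ from $\mathbb{R}^{d_0}$ to $\mathbb{R}^{d_L}$, with $A_i\in\mathbb{R}^{d_i\times d_{i-1}}$, $b_i\in\mathbb{R}^{d_i}$ and $\|(A_i|b_i)\|_\infty\leq\omega_i$, where $\|\cdot\|_\infty$ of a matrix is the induced $\ell_\infty\to\ell_\infty$ operator norm (maximal absolute row sum) and $\mathrm{ReLU}(x)=\max\{0,x\}$ entrywise. The parameters are the entries of all $A_i$, $b_i$. $\|X\|_{\max}$ is the maximal absolute value of an entry of $X$. The loss $\ell$ is Lipschitz with constant $\|\ell\|_{\mathrm{Lip}}$ in its first argument for each value of the second. For a sample $S=\{(x_i,y_i)\}_{i=1}^n$ with $X=(x_1|\cdots|x_n)\in\mathbb{R}^{d_0\times n}$, the Rademacher complexity is $\mathfrak{R}_S(\mathcal{F};\ell)=\mathbb{E}_\sigma\sup_{f\in\mathcal{F}}\frac1n\sum_{i=1}^n\sigma_i\,\ell(f(x_i),y_i)$, with $\sigma_i$ independent Rademacher variables ($\pm1$ with equal probability). $\log$ is the natural logarithm, and $\log_+(0)=0$. *)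

(* Defs.v *)
From mathcomp Require Import all_boot all_order all_algebra.
From mathcomp Require Import all_classical all_reals all_analysis.

Set Implicit Arguments.
Unset Strict Implicit.
Unset Printing Implicit Defensive.

Import Order.TTheory GRing.Theory Num.Theory.
Import numFieldNormedType.Exports.

Local Open Scope classical_set_scope.
Local Open Scope ring_scope.

(* The entrywise maximum norm of a matrix, and hence the l^oo norm of a
   vector, is mx_norm. *)

Definition linf_opnorm (R : realType) (m n : nat) (A : 'M[R]_(m, n)) : R :=
  sup [set mx_norm (A *m v) | v in [set v : 'cV[R]_n | mx_norm v <= 1]].

Lemma mx_norm_leP (R : realType) (m n : nat) (A : 'M[R]_(m, n)) (c : R) :
  0 <= c -> (mx_norm A <= c) <-> (forall i j, `|A i j| <= c).
Proof.
move=> c0; rewrite mx_normrE; split=> [/bigmax_leP[_ h] i j | h].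
  exact: (h (i, j)).
by apply/bigmax_leP; split.
Qed.

Lemma linf_opnormE (R : realType) (m n : nat) (A : 'M[R]_(m, n)) :
  linf_opnorm A = \big[Num.max/0]_i \sum_j `|A i j|.
Proof.
set M := RHS.
have M0 : 0 <= M by exact: bigmax_ge_id.
have ub : ubound [set mx_norm (A *m v) |
    v in [set v : 'cV[R]_n | mx_norm v <= 1]] M.
  move=> _ [v /= /(mx_norm_leP _ ler01) v1 <-]; apply/mx_norm_leP => // i j.
  rewrite mxE; apply: (le_trans (ler_norm_sum _ _ _)).
  apply: (@le_trans _ _ (\sum_k `|A i k|)); last exact: le_bigmax.
  by apply: ler_sum => k _; rewrite normrM ler_piMr.
have S0 : [set mx_norm (A *m v) |
    v in [set v : 'cV[R]_n | mx_norm v <= 1]] !=set0.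
  exists (mx_norm (A *m (0 : 'cV_n))), 0 => //=.
  by apply/mx_norm_leP => // i j; rewrite mxE normr0.
apply/eqP; rewrite eq_le; apply/andP; split; first exact: ge_sup.
have up x : [set mx_norm (A *m v) |
    v in [set v : 'cV[R]_n | mx_norm v <= 1]] x -> x <= linf_opnorm A.
  by move=> Sx; apply: ub_le_sup => //; exists M.
apply/bigmax_leP; split=> [|i _].
  case: S0 => x Sx; apply: le_trans (up _ Sx); case: Sx => v _ <-.
  by rewrite mx_normrE; exact: bigmax_ge_id.
pose v : 'cV[R]_n := \col_j Num.sg (A i j).
apply: (@le_trans _ _ (mx_norm (A *m v))); last first.
  apply: up; exists v => //=; apply/mx_norm_leP => // k j.
  by rewrite mxE normr_sg; case: eqP.
have -> : \sum_j `|A i j| = (A *m v) i 0.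
  by rewrite mxE; apply: eq_bigr => j _; rewrite mxE mulrC -normrEsg.
apply: le_trans (ler_norm _) _.
by apply: (mx_norm_leP _ _).1; rewrite ?lexx// mx_normrE; exact: bigmax_ge_id.
Qed.

Section networks.
Variable R : realType.

Definition relu (m n : nat) (A : 'M[R]_(m, n)) : 'M[R]_(m, n) :=
  map_mx (Num.max 0) A.

(* A i and b i are A_{i+1} and b_{i+1} in one-based numbering of the layers. *)
Fixpoint network (d : nat -> nat) (A : forall i, 'M[R]_(d i.+1, d i))
    (b : forall i, 'cV[R]_(d i.+1)) (L : nat) (x : 'cV[R]_(d 0%N)) :
    'cV[R]_(d L) :=
  if L is l.+1 then relu (A l *m network A b l x + b l) else x.

(* Only d 0, ..., d L and omega 1, ..., omega L are relevant: the entries of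
   the families A and b from index L on do not affect the network. *)
Definition ReLU_class (L : nat) (d : nat -> nat) (omega : nat -> R) :
    set ('cV[R]_(d 0%N) -> 'cV[R]_(d L)) :=
  [set f | exists (A : forall i, 'M[R]_(d i.+1, d i))
                  (b : forall i, 'cV[R]_(d i.+1)),
     (forall i, (i < L)%N -> linf_opnorm (row_mx (A i) (b i)) <= omega i.+1)
     /\ f = network A b L].

Definition num_params (L : nat) (d : nat -> nat) : nat :=
  (\sum_(1 <= i < L.+1) (d i * d i.-1 + d i))%N.

Definition l2norm (n : nat) (v : 'cV[R]_n) : R :=
  Num.sqrt (\sum_i v i 0 ^+ 2).

(* Lipschitz with respect to the Euclidean norm of R^n, for every constant K
   and not only the best one. *)
Definition lipschitz_loss (n : nat) (Y : Type) (K : R)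
    (loss : 'cV[R]_n -> Y -> R) : Prop :=
  forall y u v, `|loss u y - loss v y| <= K * l2norm (u - v).

(* The expectation over n independent Rademacher signs is the average over
   the 2 ^ n sign patterns s, with sigma_i = (-1) ^+ s i. The suprema are finite
   as soon as F is nonempty and the loss is bounded. *)
Definition rademacher (T U Y : Type) (n : nat) (F : set (T -> U))
    (loss : U -> Y -> R) (x : 'I_n -> T) (y : 'I_n -> Y) : \bar R :=
  (((2 ^+ n)^-1)%:E * \sum_(s : {ffun 'I_n -> bool})
     ereal_sup [set (n%:R^-1 * \sum_(i < n) (-1) ^+ s i * loss (f (x i)) (y i))%:E
               | f in F])%E.

Definition sup_rademacher (d0 n : nat) (U Y : Type)
    (F : set ('cV[R]_d0 -> U)) (loss : U -> Y -> R) (y : 'I_n -> Y) : \bar R :=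
  ereal_sup [set rademacher F loss (fun i => col i X) y
            | X in [set X : 'M[R]_(d0, n) | mx_norm X <= 1]].

(* The library sets ln x = 0 for x <= 0, so logp 0 = 0. *)
Definition logp (x : R) : R := Num.max 0 (ln x).

End networks.

Arguments ReLU_class {R} L d omega.

(* Main.v *)
Require Import Defs.
From mathcomp Require Import all_boot all_order all_algebra.
From mathcomp Require Import all_classical all_reals all_analysis.
From mathcomp Require Import ring lra.
Set Implicit Arguments.
Unset Strict Implicit.
Unset Printing Implicit Defensive.
Import Order.TTheory GRing.Theory Num.Theory.
Import numFieldNormedType.Exports.
Local Open Scope classical_set_scope.
Local Open Scope ring_scope.

(** Write [W] for the product of the [omega i] and [P = K sqrt(d L) W]. On inputs of
    sup norm at most [1], every network of the class has outputs of sup norm at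
    most [W], so its losses differ from those of the zero output by at most
    [alpha = min(H, P)]. Subtracting the losses of the zero output does not change
    the Rademacher complexity, and the class behaves as if its losses had
    size [alpha].

    The complexity is then estimated by discretization at the single scale
    [alpha / sqrt n]. A layer with weights [(A | b)] of operator norm at most
    [omega i] is rounded, row by row, inside an [l^1] ball of radius [omega i] with
    [l^1] error [omega i / q] ([l1_ball_net], [matrix_net]). Relative errors add
    up along the layers ([ReLU_class_net]), so the losses move by at most
    [P L / q], which is below [alpha / sqrt n] for [q] of the order of
    [L beta sqrt n], where [beta = P / alpha]. Since an [l^1] ball in dimension [D]
    has a net of size [(C q) ^ D] with [C] independent of [D], the net of the
    class has size [(C q) ^ N] for the exact number [N] of parameters; in
    particular the input dimension [d 0] enters through [N] only.

    Massart's inequality ([massart_le]) for the finite net gives the bound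
    [7 alpha sqrt(N / n) sqrt(1 + ln L + ln beta + ln n)] of
    [sup_rademacher_ReLU_class_le], from which both claims follow. In the first,
    [1 + ln L] is at most four times the sum of the [ln (d i)], each of which is
    at least [ln 2]. In the second, [N <= 2 L d ^ 2], and [alpha ^ 2 ln beta] is
    controlled by [ln P] up to the bounded term [alpha ^ 2 ln (1 / alpha) <= alpha]
    ([sqr_mul_ln_ratio_le]). *)

(** * Maxima of finitely many Rademacher sums *)

(** A sub-Gaussian bound on [cosh] with the non-optimal exponent [2 x ^ 2]: for
    [|x| >= 1 / 2] both exponents are below [2 x ^ 2], and for smaller [x] it
    follows from [1 - x <= exp (- x)] alone, through
    [1 / (1 - x) + 1 / (1 + x) = 2 / (1 - x ^ 2)]. *)
Lemma expR_add_opp_le (R : realType) (x : R) :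
  expR x + expR (- x) <= 2 * expR (2 * x ^+ 2).
Proof.
wlog x0 : x / 0 <= x => [H|].
  have [/H //|/ltW x0] := leP 0 x.
  by have := H (- x); rewrite opprK sqrrN addrC oppr_ge0; apply.
have [xl|xs] := leP 2^-1 x.
  have e1 : expR x <= expR (2 * x ^+ 2) by rewrite ler_expR; nra.
  have e2 : expR (- x) <= expR (2 * x ^+ 2) by rewrite ler_expR; nra.
  lra.
have ubV (t : R) : t < 1 -> expR t <= (1 - t)^-1.
  move=> t1; rewrite -[t in expR t]opprK expRN lef_pV2 ?posrE ?expR_gt0 ?subr_gt0//.
  exact: expR_ge1Dx.
have u1 : expR x <= (1 - x)^-1 by apply: ubV; lra.
have u2 : expR (- x) <= (1 + x)^-1 by rewrite -{2}[x]opprK; apply: ubV; lra.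
have u3 : (1 - x)^-1 + (1 + x)^-1 <= 2 * (1 + 2 * x ^+ 2).
  have -> : (1 - x)^-1 + (1 + x)^-1 = 2 / (1 - x ^+ 2).
    by field; do ?[apply/andP; split]; rewrite gt_eqF//; nra.
  rewrite ler_pdivrMr; [|nra].
  have : 0 <= x ^+ 2 * (1 - 2 * x ^+ 2) by apply: mulr_ge0; nra.
  nra.
have := expR_ge1Dx (2 * x ^+ 2); lra.
Qed.

Lemma rademacher_mgf_le (R : realType) (n : nat) (z : 'I_n -> R) (a lam : R) :
  (forall i, `|z i| <= a) ->
  \sum_(s : {ffun 'I_n -> bool}) expR (lam * \sum_i (-1) ^+ s i * z i)
  <= 2 ^+ n * expR (n%:R * (2 * (lam * a) ^+ 2)).
Proof.
move=> za.
have -> : \sum_(s : {ffun 'I_n -> bool}) expR (lam * \sum_i (-1) ^+ s i * z i) =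
    \prod_(i < n) \sum_(e : bool) expR (lam * ((-1) ^+ e * z i)).
  rewrite bigA_distr_bigA /=; apply: eq_bigr => s _.
  by rewrite mulr_sumr expR_sum.
have -> : 2 ^+ n * expR (n%:R * (2 * (lam * a) ^+ 2)) =
    \prod_(i < n) (2 * expR (2 * (lam * a) ^+ 2)).
  by rewrite prodr_const card_ord [RHS]exprMn expRM_natl.
apply: ler_prod => i _; rewrite big_bool /= expr1 expr0 mul1r mulN1r.
rewrite addr_ge0 ?expR_ge0//= addrC mulrN.
apply: le_trans (expR_add_opp_le _) _.
rewrite ler_pM2l// ler_expR ler_pM2l// !exprMn ler_wpM2l ?sqr_ge0//.
by rewrite -[leLHS]real_normK ?num_real// lerXn2r// nnegrE (le_trans _ (za i)).
Qed.

(** Massart's maximal inequality, before optimization over [lam]. In place of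
    Jensen's inequality, [ln] is bounded by its tangent line at the point
    [B exp (2 n (lam a) ^ 2)], which dominates the sum over [T] of the moment
    generating functions. *)
Lemma massart_le (R : realType) (n : nat) (T : finType) (z : T -> 'I_n -> R)
    (M : {ffun 'I_n -> bool} -> R) (a lam B : R) :
  0 < lam -> 1 <= B -> #|T|%:R <= B ->
  (forall t i, `|z t i| <= a) ->
  (forall s : {ffun 'I_n -> bool},
      exists t, M s <= \sum_i (-1) ^+ s i * z t i) ->
  (2 ^+ n)^-1 * \sum_s M s <= ln B / lam + 2 * n%:R * lam * a ^+ 2.
Proof.
move=> lam0 B1 TB za MT.
have B0 : 0 < B by lra.
set E := n%:R * (2 * (lam * a) ^+ 2).
have p2 : 0 < 2 ^+ n :> R by rewrite exprn_gt0.
pose D := B * expR E.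
have D0 : 0 < D by rewrite mulr_gt0 ?expR_gt0.
have tangent x : x <= ln D + expR x / D - 1.
  have := expR_ge1Dx (x - ln D).
  by rewrite expRD expRN lnK ?posrE//; lra.
have sumE : \sum_s expR (lam * M s) <= 2 ^+ n * D.
  apply: (@le_trans _ _ (\sum_(s : {ffun 'I_n -> bool}) \sum_t expR (lam * \sum_i (-1) ^+ s i * z t i))).
    apply: ler_sum => s _; have [t Mt] := MT s.
    rewrite (bigD1 t)//= ler_wpDr//; first by apply: sumr_ge0 => *; exact: expR_ge0.
    by rewrite ler_expR ler_pM2l.
  rewrite exchange_big /=.
  apply: (@le_trans _ _ (\sum_(t : T) 2 ^+ n * expR E)).
    by apply: ler_sum => t _; apply: rademacher_mgf_le.
  rewrite sumr_const -[leLHS]mulr_natl /D mulrCA ler_pM2l//.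
  by rewrite ler_pM2r ?expR_gt0.
have lsum : lam * \sum_s M s <= 2 ^+ n * ln D.
  rewrite mulr_sumr.
  apply: (le_trans (ler_sum _ (fun s _ => tangent (lam * M s)))).
  rewrite !big_split /= -mulr_suml !sumr_const card_ffun card_bool card_ord.
  have : (\sum_s expR (lam * M s)) / D <= 2 ^+ n by rewrite ler_pdivrMr.
  rewrite -[ln D *+ _]mulr_natr -[(- 1) *+ _]mulr_natr natrX.
  set t := _ / D; set p := 2 ^+ n; set l := ln D; lra.
rewrite mulrC ler_pdivrMr// -(ler_pM2l lam0).
apply: le_trans lsum _.
rewrite /D lnM ?posrE ?expR_gt0// expRK /E le_eqVlt; apply/orP; left; apply/eqP.
by field; rewrite lt0r_neq0.
Qed.

Lemma sum_rademacher (R : realType) (n : nat) (c : 'I_n -> R) :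
  \sum_(s : {ffun 'I_n -> bool}) \sum_i (-1) ^+ s i * c i = 0.
Proof.
rewrite exchange_big big1//= => i _; rewrite -mulr_suml.
pose flip (s : {ffun 'I_n -> bool}) : {ffun 'I_n -> bool} :=
  [ffun j => if j == i then ~~ s j else s j].
have flipK : involutive flip.
  by move=> s; apply/ffunP => j; rewrite !ffunE; case: eqP => // _; rewrite negbK.
set S := \sum_s _.
have SN : S = - S.
  rewrite {1}/S (reindex_inj (inv_inj flipK)) /S -sumrN; apply: eq_bigr => s _.
  by rewrite ffunE eqxx; case: (s i); rewrite /= ?expr1 ?expr0 ?opprK.
have -> : S = 0 by lra.
by rewrite mul0r.
Qed.

(** The centres [c] can be subtracted for free because signs have mean zero;
    so the width of the range of the loss, and not its size, enters the bound. *)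
Lemma rademacher_le_net (R : realType) (T U Y : Type) (n : nat)
    (F : set (T -> U)) (loss : U -> Y -> R) (x : 'I_n -> T) (y : 'I_n -> Y)
    (I : finType) (z : I -> 'I_n -> R) (c : 'I_n -> R) (a lam eta B : R) :
  (0 < n)%N -> (0 < #|I|)%N -> 0 < lam -> 1 <= B -> #|I|%:R <= B ->
  (forall t i, `|z t i| <= a) ->
  (forall f, F f ->
     exists t, forall i, `|loss (f (x i)) (y i) - c i - z t i| <= eta) ->
  (rademacher F loss x y <=
   (eta + (ln B / lam / n%:R + 2 * lam * a ^+ 2))%:E)%E.
Proof.
move=> n0 /card_gt0P[t0 _] lam0 B1 IB za net.
have nR : 0 < n%:R :> R by rewrite ltr0n.
pose Z (s : {ffun 'I_n -> bool}) t := \sum_i (-1) ^+ s i * z t i.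
pose M s := Z s [arg max_(t > t0) Z s t]%O.
have MP s t : Z s t <= M s by rewrite /M; case: arg_maxP => // i _; apply.
pose u (s : {ffun 'I_n -> bool}) :=
  n%:R^-1 * (\sum_i (-1) ^+ s i * c i + M s) + eta.
have supu (s : {ffun 'I_n -> bool}) : (ereal_sup [set (n%:R^-1 * \sum_(i < n)
      (-1) ^+ s i * loss (f (x i)) (y i))%:E | f in F] <= (u s)%:E)%E.
  apply: ge_ereal_sup => _ [f /net[t ft] <-]; rewrite lee_fin /u.
  have -> : eta = n%:R^-1 * \sum_(i < n) eta.
    by rewrite sumr_const card_ord -[eta *+ n]mulr_natl mulKf ?gt_eqF.
  rewrite -mulrDr ler_pM2l ?invr_gt0//.
  apply: (@le_trans _ _ (\sum_i (-1) ^+ s i * c i + Z s t + \sum_(i < n) eta)).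
    rewrite -!big_split /=; apply: ler_sum => i _.
    rewrite -mulrDr -lerBlDl -mulrBr opprD addrA.
    apply: le_trans (ler_norm _) _.
    by rewrite normrM normrX normrN1 expr1n mul1r.
  by rewrite lerD2r lerD2l.
rewrite /rademacher.
apply: (@le_trans _ _ (((2 ^+ n)^-1)%:E * \sum_(s : {ffun 'I_n -> bool}) (u s)%:E)%E).
  by apply: lee_wpmul2l; [rewrite lee_fin invr_ge0 exprn_ge0|apply: lee_sum].
rewrite sumEFin -EFinM lee_fin /u big_split /= -mulr_sumr big_split /=.
rewrite sum_rademacher add0r sumr_const card_ffun card_bool card_ord mulrDr.
rewrite addrC -[eta *+ _]mulr_natl natrX mulKf ?expf_neq0// lerD2l.
rewrite mulrCA mulrC ler_pdivrMr//.
apply: le_trans (massart_le lam0 B1 IB za _) _.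
  by move=> s; exists [arg max_(t > t0) Z s t]%O; exact: lexx.
rewrite le_eqVlt; apply/orP; left; apply/eqP.
by field; rewrite !lt0r_neq0.
Qed.

(** * Nets for bounded weights and for networks *)

(** The binomial coefficient is the number of vectors of [nat ^ D] of sum at most
    [D q]. Multiplied by [q ^ (D q)], it is a single term of the binomial
    expansion of [(1 + q) ^ (D (q + 1))]. *)
Lemma bin_mul_le (R : realType) (D q : nat) : (0 < q)%N ->
  'C(D + D * q, D)%:R <= (expR 1 * q.+1%:R) ^+ D :> R.
Proof.
move=> q0.
have nat_le : ('C(D + D * q, D) * q ^ (D * q) <= (q.+1) ^ (D * q.+1))%N.
  rewrite mulnS -[X in (_ <= X ^ _)%N]addn1 expnDn.
  have lt : (D < (D + D * q).+1)%N by rewrite ltnS leq_addr.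
  by rewrite (bigD1 (Ordinal lt))//= addKn exp1n muln1 leq_addr.
have qR : 0 < q%:R :> R by rewrite ltr0n.
have real_le : 'C(D + D * q, D)%:R * (q%:R ^+ q) ^+ D <= (q.+1%:R ^+ q.+1) ^+ D :> R.
  by rewrite -!exprM -!natrX -natrM ler_nat ![(_ * D)%N]mulnC.
rewrite -(ler_pM2r (x := (q%:R ^+ q) ^+ D)) ?exprn_gt0//.
apply: le_trans real_le _; rewrite -exprMn; apply: lerXn2r; rewrite ?nnegrE.
- by rewrite exprn_ge0.
- by rewrite !mulr_ge0 ?expR_ge0 ?exprn_ge0.
rewrite exprS [expR 1 * _]mulrC -mulrA ler_pM2l ?ltr0n//.
have e1 : q.+1%:R <= expR q%:R^-1 * q%:R :> R.
  apply: le_trans (ler_wpM2r (ltW qR) (expR_ge1Dx _)).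
  by rewrite mulrDl mul1r mulVf ?gt_eqF// natr1.
rewrite -[X in expR X](mulfV (x := q%:R)) ?gt_eqF// expRM_natl -exprMn.
by rewrite lerXn2r// nnegrE ?mulr_ge0 ?expR_ge0.
Qed.

(** A vector of the [l^1] ball of radius [w] is rounded towards zero, coordinate
    by coordinate, to multiples of [w / (D q)]. The rounded moduli are integers
    of sum at most [D q]: this is what keeps the size exponential in [D] with a
    base that does not depend on [D]. *)
Lemma l1_ball_net (R : realType) (D q : nat) (w : R) :
  (0 < D)%N -> (0 < q)%N -> 0 < w ->
  exists (T : finType) (v : T -> 'I_D -> R),
    [/\ #|T|%:R <= (2 * expR 1 * q.+1%:R : R) ^+ D,
        forall t, \sum_j `|v t j| <= w &
        forall u : 'I_D -> R, \sum_j `|u j| <= w ->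
          exists t, \sum_j `|u j - v t j| <= w / q%:R].
Proof.
move=> D0 q0 w0.
have DR : 0 < D%:R :> R by rewrite ltr0n.
have qR : 0 < q%:R :> R by rewrite ltr0n.
pose h := w / (D * q)%:R.
have h0 : 0 < h by rewrite divr_gt0// natrM mulr_gt0.
have hE : h * (D * q)%:R = w by rewrite divfK// natrM mulf_neq0 ?gt_eqF.
pose P : {set D.-tuple 'I_(D * q).+1} :=
  [set t : D.-tuple 'I_(D * q).+1 | (\sum_(i <- t) i <= D * q)%N]%SET.
pose v (t : {ffun 'I_D -> bool} * {t | t \in P}) (j : 'I_D) : R :=
  (-1) ^+ t.1 j * ((tnth (val t.2) j : nat)%:R * h).
have vE t j : `|v t j| = (tnth (val t.2) j : nat)%:R * h.
  rewrite /v normrM normrX normrN1 expr1n mul1r ger0_norm//.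
  by rewrite mulr_ge0// ltW.
exists ({ffun 'I_D -> bool} * {t | t \in P})%type, v; split.
- rewrite card_prod card_ffun card_bool card_ord card_sig.
  rewrite (eq_card (B := P)); last by move=> t; rewrite inE.
  rewrite card_partial_ord_partitions natrM natrX -mulrA exprMn.
  by rewrite ler_pM2l ?exprn_gt0// bin_mul_le.
- move=> t; rewrite (eq_bigr _ (fun j _ => vE t j)) -mulr_suml -natr_sum.
  rewrite -hE mulrC ler_pM2l// ler_nat.
  by have := valP t.2; rewrite inE big_tuple.
- move=> u uw; pose k j := Num.truncn (`|u j| / h).
  have kP j : (k j)%:R * h <= `|u j| < (k j).+1%:R * h.
    rewrite -ler_pdivlMr// -ltr_pdivrMr//; apply: truncn_itv.
    by rewrite divr_ge0// ltW.
  have ksum : (\sum_j k j <= D * q)%N.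
    rewrite -(ler_nat R) natr_sum -(ler_pM2r h0) mulr_suml [leRHS]mulrC hE.
    by apply: le_trans uw; apply: ler_sum => j _; case/andP: (kP j).
  have klt j : (k j < (D * q).+1)%N.
    by rewrite ltnS; apply: leq_trans ksum; rewrite (bigD1 j)//= leq_addr.
  pose t := [tuple Ordinal (klt j) | j < D].
  have tP : t \in P.
    by rewrite inE big_tuple; under eq_bigr do rewrite tnth_mktuple.
  exists ([ffun j => u j < 0], exist _ t tP).
  have -> : w / q%:R = \sum_(j < D) h.
    rewrite sumr_const card_ord -[RHS]mulr_natr -hE natrM mulrA mulfK ?gt_eqF//.
  apply: ler_sum => j _.
  have -> : `|u j - v ([ffun j => u j < 0], exist _ t tP) j| = `| `|u j| - (k j)%:R * h|.
    rewrite /v /= tnth_mktuple ffunE.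
    have [uj|uj] := ltP (u j) 0 => /=.
      by rewrite (ltr0_norm uj) expr1 mulN1r opprK -normrN opprD.
    by rewrite (ger0_norm uj) expr0 mul1r.
  have /andP[k1 k2] := kP j.
  rewrite ger0_norm ?subr_ge0// lerBlDl.
  by move: k2; rewrite -natr1 mulrDl mul1r => /ltW.
Qed.

(** Rows are rounded independently, so the sizes of their nets multiply and the
    exponent is the number of entries. *)
Lemma matrix_net (R : realType) (m D q : nat) (w : R) :
  (0 < D)%N -> (0 < q)%N -> 0 < w ->
  exists (T : finType) (v : T -> 'M[R]_(m, D)),
    [/\ #|T|%:R <= (2 * expR 1 * q.+1%:R : R) ^+ (m * D),
        forall t i, \sum_j `|v t i j| <= w &
        forall U : 'M[R]_(m, D), (forall i, \sum_j `|U i j| <= w) ->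
          exists t, forall i, \sum_j `|(U - v t) i j| <= w / q%:R].
Proof.
move=> D0 q0 w0; have [T [v [cT vw net]]] := l1_ball_net D0 q0 w0.
exists {ffun 'I_m -> T}, (fun t : {ffun 'I_m -> T} => \matrix_(i, j) v (t i) j); split.
- rewrite card_ffun card_ord natrX mulnC exprM.
  by rewrite lerXn2r// nnegrE// exprn_ge0// !mulr_ge0 ?expR_ge0.
- by move=> t i; under eq_bigr do rewrite mxE.
- move=> U Uw.
  have [t tP] := choice (fun i => net (fun j => U i j) (Uw i)).
  exists [ffun i => t i] => i.
  by under eq_bigr do rewrite !mxE ffunE; exact: tP.
Qed.

(** The bias is the column of [(A | b)] that multiplies the constant input
    [1], which is why the bound [V] on the input has to be at least [1]. *)
Lemma affine_le (R : realType) (m n : nat) (A : 'M[R]_(m, n)) (b : 'cV[R]_m)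
    (x : 'cV[R]_n) (w V : R) (i : 'I_m) :
  1 <= V -> (forall j, `|x j 0| <= V) ->
  \sum_j `|row_mx A b i j| <= w -> `|(A *m x + b) i 0| <= w * V.
Proof.
move=> V1 xV; rewrite big_split_ord /= big_ord1 => rw.
apply: (@le_trans _ _ ((\sum_j `|A i j| + `|b i 0|) * V)); last first.
  apply: ler_wpM2r; first lra.
  by apply: le_trans rw; under eq_bigr do rewrite row_mxEl; rewrite row_mxEr lerD2l.
rewrite !mxE (le_trans (ler_normD _ _))// mulrDl lerD//; last first.
  by rewrite ler_peMr.
rewrite (le_trans (ler_norm_sum _ _ _))// mulr_suml; apply: ler_sum => j _.
by rewrite normrM ler_wpM2l.
Qed.

Lemma linear_le (R : realType) (m n : nat) (A : 'M[R]_(m, n)) (b : 'cV[R]_m)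
    (x : 'cV[R]_n) (w V : R) (i : 'I_m) :
  0 <= V -> (forall j, `|x j 0| <= V) ->
  \sum_j `|row_mx A b i j| <= w -> `|(A *m x) i 0| <= w * V.
Proof.
move=> V0 xV; rewrite big_split_ord /= big_ord1 => rw.
apply: (@le_trans _ _ ((\sum_j `|A i j|) * V)); last first.
  apply: ler_wpM2r => //; apply: le_trans rw.
  by under eq_bigr do rewrite row_mxEl; rewrite lerDl.
rewrite mxE (le_trans (ler_norm_sum _ _ _))// mulr_suml; apply: ler_sum => j _.
by rewrite normrM ler_wpM2l.
Qed.

Lemma relu_dist_le (R : realType) (m : nat) (u v : 'cV[R]_m) (i : 'I_m) :
  `|relu u i 0 - relu v i 0| <= `|u i 0 - v i 0|.
Proof.
rewrite !mxE; set a := u i 0; set b := v i 0.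
case: (leP 0 a) => a0; case: (leP 0 b) => b0; rewrite ?subrr ?normr0//.
  by rewrite subr0 ger0_norm// ger0_norm; lra.
by rewrite sub0r normrN ger0_norm// ler0_norm; lra.
Qed.

Lemma relu_norm_le (R : realType) (m : nat) (u : 'cV[R]_m) (i : 'I_m) :
  `|relu u i 0| <= `|u i 0|.
Proof.
have := relu_dist_le u 0 i.
by rewrite [relu 0 i 0]mxE [(0 : 'cV_m) i 0]mxE maxxx !subr0.
Qed.

Lemma linf_opnorm_row_le (R : realType) (m n : nat) (A : 'M[R]_(m, n)) (w : R) :
  linf_opnorm A <= w -> forall i, \sum_j `|A i j| <= w.
Proof. by rewrite linf_opnormE => /bigmax_leP[_ h] i; exact: h. Qed.

Lemma prod_ge1 (R : realType) (L : nat) (omega : nat -> R) :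
  (forall i, (1 <= i <= L)%N -> 1 <= omega i) ->
  1 <= \prod_(1 <= i < L.+1) omega i.
Proof.
elim: L => [|L IH] om; first by rewrite big_geq.
rewrite big_nat_recr//= mulr_ege1 ?om ?leqnn// IH// => i /andP[i1 iL].
by rewrite om// i1 leqW.
Qed.

Lemma ReLU_class_bound (R : realType) (L : nat) (d : nat -> nat)
    (omega : nat -> R) (f : 'cV[R]_(d 0%N) -> 'cV[R]_(d L)) (x : 'cV[R]_(d 0%N)) :
  (forall i, (1 <= i <= L)%N -> 1 <= omega i) ->
  ReLU_class L d omega f -> (forall j, `|x j 0| <= 1) ->
  forall j, `|f x j 0| <= \prod_(1 <= i < L.+1) omega i.
Proof.
move=> + [A [b [+ ->]]] x1; elim: L {f} => [|L IH] om Ab j.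
  by rewrite big_geq//; exact: x1.
have om' i : (1 <= i <= L)%N -> 1 <= omega i.
  by move=> /andP[i1 iL]; rewrite om// i1 leqW.
rewrite big_nat_recr//= mulrC; apply: le_trans (relu_norm_le _ _) _.
apply: affine_le; first exact: prod_ge1.
  by apply: IH => // i iL; apply: Ab; rewrite ltnS ltnW.
exact/linf_opnorm_row_le/Ab.
Qed.

(** Replacing the weights of one layer by their rounding costs a relative error
    [1 / q] of the largest possible output of that layer; since a layer
    expands distances at most as much as it expands that largest output,
    relative errors simply add up along the [L] layers. *)
Lemma ReLU_class_net (R : realType) (L : nat) (d : nat -> nat)
    (omega : nat -> R) (q : nat) :
  (0 < q)%N -> (forall i, (1 <= i <= L)%N -> 1 <= omega i) ->
  exists (T : finType) (g : T -> 'cV[R]_(d 0%N) -> 'cV[R]_(d L)),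
    [/\ #|T|%:R <= (2 * expR 1 * q.+1%:R : R) ^+ num_params L d, (0 < #|T|)%N,
        forall t (x : 'cV[R]_(d 0%N)), (forall j, `|x j 0| <= 1) ->
          forall j, `|g t x j 0| <= \prod_(1 <= i < L.+1) omega i &
        forall f, ReLU_class L d omega f -> exists t, forall x : 'cV[R]_(d 0%N),
          (forall j, `|x j 0| <= 1) -> forall j,
          `|f x j 0 - g t x j 0| <= L%:R / q%:R * \prod_(1 <= i < L.+1) omega i].
Proof.
move=> q0; have qR : 0 < q%:R :> R by rewrite ltr0n.
elim: L => [_|L IH om].
  exists unit, (fun _ x => x); split.
  - by rewrite card_unit /num_params big_geq.
  - by rewrite card_unit.
  - by move=> _ x x1 j; rewrite big_geq.
  - move=> f [A [b [_ ->]]]; exists tt => x _ j /=.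
    by rewrite subrr normr0 !mul0r.
have om' i : (1 <= i <= L)%N -> 1 <= omega i.
  by move=> /andP[i1 iL]; rewrite om// i1 leqW.
have {IH}[T [g [cT T0 gW net]]] := IH om'.
set W := \prod_(1 <= i < L.+1) omega i in gW net.
have W1 : 1 <= W by exact: prod_ge1.
set w := omega L.+1; have w1 : 1 <= w by apply: om; rewrite leqnn.
have w0 : 0 < w by lra.
have D0 : (0 < d L + 1)%N by rewrite addn1.
have [T' [v [cT' vw net']]] := matrix_net (d L.+1) D0 q0 w0.
have {}vw t : forall i, \sum_j `|row_mx (lsubmx (v t)) (rsubmx (v t)) i j| <= w.
  by rewrite hsubmxK; exact: vw.
pose G (t : T * T') x :=
  relu (lsubmx (v t.2) *m g t.1 x + rsubmx (v t.2)).
have WE : \prod_(1 <= i < L.+2) omega i = w * W by rewrite big_nat_recr//= mulrC.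
exists (T * T')%type, G; split.
- rewrite card_prod natrM /num_params big_nat_recr//= exprD.
  by apply: ler_pM => //; move: cT'; rewrite mulnDr muln1.
- rewrite card_prod muln_gt0 T0 /=.
  have [|t _] := net' 0; last by apply/card_gt0P; exists t.
  by move=> i; rewrite big1 ?ltW// => j _; rewrite mxE normr0.
- move=> t x x1 j; rewrite WE; apply: le_trans (relu_norm_le _ _) _.
  by apply: affine_le => // i; exact: gW.
- move=> f [A [b [Ab ->]]].
  have [|t tP] := net (network A b L).
    by exists A, b; split=> // i iL; apply: Ab; rewrite ltnS ltnW.
  have [t' t'P] := net' (row_mx (A L) (b L)) (linf_opnorm_row_le (Ab L (ltnSn L))).
  exists (t, t') => x x1 j /=; apply: le_trans (relu_dist_le _ _ _) _ => /=.
  set F := network A b L x; set y := g t x.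
  set A' := lsubmx (v t'); set b' := rsubmx (v t').
  (* the error splits into that of the input and that of the weights *)
  have -> : (A L *m F + b L) j 0 - (A' *m y + b') j 0 =
      (A L *m (F - y)) j 0 + ((A L - A') *m y + (b L - b')) j 0.
    by rewrite mulmxBr mulmxBl !mxE; ring.
  apply: le_trans (ler_normD _ _) _; rewrite WE.
  have e1 : `|(A L *m (F - y)) j 0| <= w * (L%:R / q%:R * W).
    apply: (linear_le (b := b L)); first by rewrite mulr_ge0 ?divr_ge0//; lra.
      by move=> i; rewrite !mxE; exact: tP.
    exact: linf_opnorm_row_le (Ab L (ltnSn L)) j.
  have e2 : `|((A L - A') *m y + (b L - b')) j 0| <= w / q%:R * W.
    apply: affine_le => //; first by move=> i; exact: gW.
    have := t'P j; rewrite -[v t']hsubmxK -/A' -/b'.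
    by rewrite opp_row_mx add_row_mx.
  apply: le_trans (lerD e1 e2) _.
  rewrite -natr1 le_eqVlt; apply/orP; left; apply/eqP.
  by field; rewrite gt_eqF.
Qed.

(** * Rademacher complexity of the network class *)

Lemma l2norm_le (R : realType) (m : nat) (u : 'cV[R]_m) (V : R) :
  0 <= V -> (forall i, `|u i 0| <= V) -> l2norm u <= Num.sqrt m%:R * V.
Proof.
move=> V0 uV; rewrite /l2norm -[V in leRHS]ger0_norm// -sqrtr_sqr -sqrtrM//.
rewrite ler_wsqrtr//.
have -> : m%:R * V ^+ 2 = \sum_(i < m) V ^+ 2.
  by rewrite sumr_const card_ord -[RHS]mulr_natl.
apply: ler_sum => i _; rewrite -[leLHS]real_normK ?num_real//.
by rewrite lerXn2r// nnegrE.
Qed.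

Lemma lipschitz_loss_ge0 (R : realType) (m : nat) (Y : Type) (K : R)
    (loss : 'cV[R]_m -> Y -> R) (y : Y) :
  (0 < m)%N -> lipschitz_loss K loss -> 0 <= K.
Proof.
move=> m0 /(_ y (const_mx 1) 0); rewrite subr0 => /(le_trans (normr_ge0 _)).
rewrite pmulr_lge0// /l2norm sqrtr_gt0.
under eq_bigr do rewrite mxE expr1n.
by rewrite sumr_const card_ord ltr0n.
Qed.

Lemma ln2_ge_half (R : realType) : 2^-1 <= ln (2 : R).
Proof.
have := @le_ln1Dx R (- 2^-1).
have -> : 1 + - 2^-1 = 2^-1 :> R by lra.
rewrite lnV ?posrE// => /(_ _); lra.
Qed.

Section class_bound.
Context (R : realType) (L : nat) (d : nat -> nat) (omega : nat -> R) (n : nat)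
  (Y : Type) (loss : 'cV[R]_(d L) -> Y -> R) (K H : R) (y : 'I_n -> Y).
Hypotheses (L0 : (0 < L)%N) (n0 : (0 < n)%N) (dL0 : (0 < d L)%N)
  (omega1 : forall i, (1 <= i <= L)%N -> 1 <= omega i)
  (lossK : lipschitz_loss K loss) (lossH : forall u z, 0 <= loss u z <= H).

Let N := num_params L d.
Let W := \prod_(1 <= i < L.+1) omega i.
Let P := K * Num.sqrt (d L)%:R * W.
Let alpha := Num.min H P.
Let beta := alpha^-1 * P.
Let y0 := y (Ordinal n0).

Let W1 : 1 <= W. Proof. exact: prod_ge1. Qed.

Let K0 : 0 <= K. Proof. exact: lipschitz_loss_ge0 y0 dL0 lossK. Qed.

Let KdL0 : 0 <= K * Num.sqrt (d L)%:R.
Proof. by rewrite mulr_ge0 ?sqrtr_ge0. Qed.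

Lemma class_range_ge0 : 0 <= alpha.
Proof.
rewrite le_min; apply/andP; split.
  by have /andP[l0 lH] := lossH 0 y0; exact: le_trans lH.
by rewrite mulr_ge0//; move: W1; lra.
Qed.

Let beta_ge1 : 0 < alpha -> 1 <= beta.
Proof.
by move=> a0; rewrite /beta mulrC ler_pdivlMr// mul1r ge_min lexx orbT.
Qed.

Lemma ln_ratio_ge0 : 0 <= ln beta.
Proof.
have := class_range_ge0; rewrite le_eqVlt => /predU1P[az|a0].
  by rewrite /beta -az invr0 mul0r ln0.
by rewrite ln_ge0// beta_ge1.
Qed.

Lemma num_params_gt0 : (0 < N)%N.
Proof.
rewrite /N /num_params; case: (L) L0 dL0 => // l _ dl.
by rewrite big_nat_recr//= !addn_gt0 dl !orbT.
Qed.

Let loss_dist (u v : 'cV[R]_(d L)) z (V : R) :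
  0 <= V -> (forall j, `|u j 0 - v j 0| <= V) ->
  `|loss u z - loss v z| <= K * Num.sqrt (d L)%:R * V.
Proof.
move=> V0 uv; apply: le_trans (lossK z u v) _.
rewrite -mulrA ler_wpM2l// l2norm_le// => j.
by rewrite !mxE.
Qed.

Let loss_range (u : 'cV[R]_(d L)) z : (forall j, `|u j 0| <= W) ->
  `|loss u z - loss 0 z| <= alpha.
Proof.
move=> uW; rewrite le_min; apply/andP; split.
  by rewrite ler_norml; move: (lossH u z) (lossH 0 z); lra.
by apply: loss_dist => [|j]; [move: W1; lra|rewrite [(0 : 'cV_ _) j 0]mxE subr0].
Qed.

(** A net of precision [alpha / sqrt n] has size [(C L beta sqrt n) ^ N]. Its
    precision is below the error [alpha sqrt(N / n)] that Massart's inequality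
    has in any case, and the logarithm of its size is at most [4 N] times the
    expression under the last square root. *)
Lemma rademacher_ReLU_class_le (x : 'I_n -> 'cV[R]_(d 0%N)) :
  (forall i j, `|x i j 0| <= 1) ->
  (rademacher (ReLU_class L d omega) loss x y <=
   (7 * (alpha * (Num.sqrt (N%:R / n%:R) *
     Num.sqrt (1 + ln L%:R + ln beta + ln n%:R))))%:E)%E.
Proof.
move=> x1.
have class_range f i : ReLU_class L d omega f ->
    `|loss (f (x i)) (y i) - loss 0 (y i)| <= alpha.
  by move=> Ff; apply: loss_range; apply: ReLU_class_bound (x1 i).
have := class_range_ge0; rewrite le_eqVlt => /predU1P[a0|a0].
  (* all members of the class have the same losses on the sample *)
  rewrite -a0 mul0r mulr0.
  have := @rademacher_le_net R _ _ _ n (ReLU_class L d omega) loss x y unit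
    (fun _ _ => 0) (fun i => loss 0 (y i)) 0 1 0 1 n0.
  rewrite card_unit ln1 expr0n /= !mul0r !mulr0 !addr0; apply => //.
    by move=> _ _; rewrite normr0.
  by move=> f Ff; exists tt => i; rewrite subr0 a0; exact: class_range.
have b1 := beta_ge1 a0.
have nR : 1 <= n%:R :> R by rewrite ler1n.
have LR : 1 <= L%:R :> R by rewrite ler1n.
have NR : 1 <= N%:R :> R by rewrite ler1n num_params_gt0.
have sn1 : 1 <= Num.sqrt n%:R :> R by rewrite -[leLHS]sqrtr1 ler_wsqrtr.
set Lam := 1 + ln L%:R + ln beta + ln n%:R.
have lnL0 : 0 <= ln L%:R :> R by exact: ln_ge0.
have lnn0 : 0 <= ln n%:R :> R by exact: ln_ge0.
have lnb0 := ln_ratio_ge0.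
have Lam1 : 1 <= Lam by rewrite /Lam; lra.
set S := Num.sqrt (N%:R / n%:R) * Num.sqrt Lam.
have S2 : S ^+ 2 = N%:R * Lam / n%:R.
  by rewrite exprMn !sqr_sqrtr ?divr_ge0//; [rewrite mulrAC|lra].
have S0 : 0 < S.
  by rewrite mulr_gt0// sqrtr_gt0 ?divr_gt0//; lra.
(* with q >= L beta sqrt n, the net has precision alpha / sqrt n *)
pose r := L%:R * (beta * Num.sqrt n%:R).
have r1 : 1 <= r by apply: mulr_ege1 => //; exact: mulr_ege1.
pose q := (Num.truncn r).+1.
have /andP[qr rq] : (Num.truncn r)%:R <= r < q%:R by apply: truncn_itv; lra.
have qr1 : q%:R <= r + 1 by rewrite -natr1 lerD2r.
have [T [g [cT T0 gW net]]] := ReLU_class_net d (isT : (0 < q)%N) omega1.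
pose z t i := loss (g t (x i)) (y i) - loss 0 (y i).
have za t i : `|z t i| <= alpha by apply: loss_range => j; exact: gW.
pose eta := alpha / Num.sqrt n%:R.
have netz f : ReLU_class L d omega f -> exists t, forall i,
    `|loss (f (x i)) (y i) - loss 0 (y i) - z t i| <= eta.
  move=> /net[t tP]; exists t => i.
  have -> : loss (f (x i)) (y i) - loss 0 (y i) - z t i =
      loss (f (x i)) (y i) - loss (g t (x i)) (y i) by rewrite /z; ring.
  apply: le_trans (loss_dist _ _ (tP _ (x1 i))) _.
    by rewrite mulr_ge0 ?divr_ge0//; exact: le_trans ler01 W1.
  rewrite mulrCA -/W -/P.
  have PE : P = alpha * beta by rewrite /beta mulrA mulfV ?mul1r ?gt_eqF.
  rewrite PE /eta [leLHS]mulrCA ler_pM2l//.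
  rewrite [leLHS]mulrAC ler_pdivrMr; last by rewrite (lt_trans _ rq)//; lra.
  rewrite [leRHS]mulrC ler_pdivlMr; last lra.
  by move: rq; rewrite /r; lra.
set Q := 2 * expR 1 * q.+1%:R in cT.
have e1 : 1 <= expR 1 :> R by rewrite -{1}(@expR0 R) ler_expR.
have Q1 : 1 <= Q.
  by apply: mulr_ege1; rewrite ?ler1n//; apply: mulr_ege1; rewrite ?ler1n.
have lnQ : ln Q <= 4 * Lam.
  have q0 : 0 < q.+1%:R :> R by rewrite ltr0n.
  rewrite /Q !lnM ?posrE ?mulr_gt0 ?expR_gt0// expRK.
  have l2 : ln 2 <= 1 :> R by have := @le_ln1Dx R 1; lra.
  have l3 : ln 3 <= 2 :> R by have := @le_ln1Dx R 2; lra.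
  have lq : ln q.+1%:R <= ln (3 * r).
    by rewrite ler_ln ?posrE//; rewrite -?natr1; lra.
  have lr : ln r = ln L%:R + (ln beta + ln (Num.sqrt n%:R)).
    have [Lp bp sp] : [/\ 0 < L%:R :> R, 0 < beta & 0 < Num.sqrt n%:R :> R].
      by split; lra.
    rewrite /r lnM; [congr (_ + _); exact: lnM|by []|].
    by rewrite posrE mulr_gt0.
  have ls : ln (Num.sqrt n%:R) <= ln n%:R :> R.
    rewrite ler_ln ?posrE; [|lra|lra].
    by rewrite -[leRHS]sqr_sqrtr; [nra|lra].
  move: lq; rewrite lnM ?posrE; [|lra|lra].
  by rewrite lr /Lam; lra.
pose lam := S / alpha.
have lam0 : 0 < lam by rewrite divr_gt0.
have QN1 : 1 <= Q ^+ N by exact: exprn_ege1.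
apply: le_trans (rademacher_le_net n0 T0 lam0 QN1 cT za netz) _.
rewrite lee_fin.
have etaS : eta <= alpha * S.
  rewrite ler_pM2l// -(@ler_sqr R) ?nnegrE ?invr_ge0 ?(ltW S0)//.
  rewrite exprVn sqr_sqrtr; last lra.
  rewrite S2 -[leLHS]mul1r ler_pM2r ?invr_gt0; [|lra].
  by rewrite mulr_ege1.
have main : ln (Q ^+ N) / lam / n%:R <= 4 * (alpha * S).
  rewrite lnXn; last lra.
  rewrite -[ln Q *+ N]mulr_natl.
  have -> : 4 * (alpha * S) = N%:R * (4 * Lam) / lam / n%:R.
    have -> : N%:R * (4 * Lam) / lam / n%:R = 4 * (N%:R * Lam / n%:R) / lam by ring.
    by rewrite -S2 /lam; field; rewrite !gt_eqF.
  rewrite ler_pM2r ?invr_gt0; [|lra]; rewrite ler_pM2r ?invr_gt0//.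
  by rewrite ler_pM2l//; lra.
have -> : 2 * lam * alpha ^+ 2 = 2 * (alpha * S).
  by rewrite /lam; field; rewrite gt_eqF.
lra.
Qed.

Lemma sup_rademacher_ReLU_class_le :
  (sup_rademacher (ReLU_class L d omega) loss y <=
   (7 * (alpha * (Num.sqrt (N%:R / n%:R) *
     Num.sqrt (1 + ln L%:R + ln beta + ln n%:R))))%:E)%E.
Proof.
apply: ge_ereal_sup => _ [X /= X1 <-]; apply: rademacher_ReLU_class_le => i j.
by rewrite mxE; exact: ((mx_norm_leP _ ler01).1 X1).
Qed.

End class_bound.

(** * Consequences for the two forms of the bound *)

(** The logarithm of a depth is absorbed by the logarithms of the widths because
    each layer contributes at least [ln 2 >= 1 / 2] to the sum. *)
Lemma ln_depth_le (R : realType) (L : nat) (d : nat -> nat) :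
  (0 < L)%N -> (forall i, (1 <= i <= L)%N -> (2 <= d i)%N) ->
  1 + ln L%:R <= 4 * \sum_(1 <= i < L.+1) ln (d i)%:R :> R.
Proof.
move=> L0 d2.
have LR : 1 <= L%:R :> R by rewrite ler1n.
have lnL : ln L%:R <= L%:R :> R by rewrite ltW// ln_sublinear// ltr0n.
have sumd : L%:R * 2^-1 <= \sum_(1 <= i < L.+1) ln (d i)%:R :> R.
  have -> : L%:R * 2^-1 = \sum_(1 <= i < L.+1) 2^-1 :> R.
    by rewrite sumr_const_nat subn1 -[RHS]mulr_natl.
  rewrite !big_nat; apply: ler_sum => i iL.
  have di := d2 i iL.
  apply: le_trans (ln2_ge_half R) _.
  by rewrite ler_ln ?posrE ?ler_nat ?ltr0n// ltnW.
lra.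
Qed.

(** The factor [a ^ 2] tames [ln (1 / a)] for small [a], as
    [a ^ 2 ln (1 / a) <= a]: the bound is uniform in [a <= h]. *)
Lemma sqr_mul_ln_ratio_le (R : realType) (a h P M : R) :
  0 <= a -> a <= h -> a <= P -> 0 <= M -> (0 < P -> ln P <= M) ->
  a ^+ 2 * ln (a^-1 * P) <= h ^+ 2 * M + h.
Proof.
move=> a0 ah aP M0 lnP; have h0 : 0 <= h by exact: le_trans ah.
have [->|az] := eqVneq a 0.
  by rewrite expr0n mul0r addr_ge0// mulr_ge0 ?sqr_ge0.
have ap : 0 < a by rewrite lt_neqAle eq_sym az.
have P0 : 0 < P := lt_le_trans ap aP.
have ai : 0 < a^-1 by rewrite invr_gt0.
rewrite lnM ?posrE// mulrDr addrC lerD//.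
  apply: (le_trans (ler_wpM2l (sqr_ge0 a) (lnP P0))).
  by rewrite ler_wpM2r// lerXn2r.
apply: (le_trans (ler_wpM2l (sqr_ge0 a) (ltW (ln_sublinear ai)))).
by rewrite expr2 mulfK.
Qed.

Theorem theorem3p22 (R : realType) :
  (exists2 c : R, 0 < c &
    forall (L : nat) (d : nat -> nat) (omega : nat -> R) (n : nat)
           (Y : Type) (loss : 'cV[R]_(d L) -> Y -> R) (K H : R) (y : 'I_n -> Y),
      (0 < L)%N -> (0 < n)%N ->
      (forall i, (i <= L)%N -> (2 <= d i)%N) ->
      (forall i, (1 <= i <= L)%N -> 2 <= omega i) ->
      lipschitz_loss K loss ->
      (forall u z, 0 <= loss u z <= H) ->
      let N := num_params L d in
      let P := K * Num.sqrt (d L)%:R * \prod_(1 <= i < L.+1) omega i in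
      let alpha := Num.min H P in
      let beta := alpha^-1 * P in
      (sup_rademacher (ReLU_class L d omega) loss y <=
       (c * alpha * Num.sqrt (N%:R / n%:R) *
        Num.sqrt (ln beta + ln n%:R + \sum_(1 <= i < L.+1) ln (d i)%:R
                  + L%:R * logp (logp (beta * Num.sqrt (n%:R / (d L)%:R)))))%:E)%E)
  /\
  (forall CK CH Cn : R, exists2 C : R, 0 < C &
    forall (L d : nat) (omega : R) (n : nat)
           (Y : Type) (loss : 'cV[R]_d -> Y -> R) (K H : R) (y : 'I_n -> Y),
      (0 < L)%N -> (0 < n)%N -> (2 <= d)%N -> 2 <= omega ->
      lipschitz_loss K loss ->
      (forall u z, 0 <= loss u z <= H) ->
      K <= CK -> H <= CH ->
      ln n%:R <= Cn * (L%:R * ln (d%:R * L%:R)) ->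
      (sup_rademacher (ReLU_class L (fun=> d) (fun=> omega)) loss y <=
       (C * ((Num.sqrt n%:R)^-1 * (d%:R * L%:R)
             * Num.sqrt (ln (d%:R * L%:R * omega))))%:E)%E).
Proof.
split.
  exists 14; first by [].
  move=> L d omega n Y loss K H y L0 n0 d2 om2 lossK lossH; lazy zeta.
  set N := num_params L d; set P := K * _ * _.
  set alpha := Num.min H P; set beta := alpha^-1 * P.
  have om1 i : (1 <= i <= L)%N -> 1 <= omega i.
    by move=> /om2; lra.
  have dL0 : (0 < d L)%N by rewrite (leq_trans _ (d2 L _)).
  apply: le_trans (sup_rademacher_ReLU_class_le y L0 n0 dL0 om1 lossK lossH) _.
  rewrite -/N -/P -/alpha -/beta lee_fin.
  set Lam := 1 + _ + _ + _; set S := _ + L%:R * _.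
  have a0 : 0 <= alpha := class_range_ge0 y n0 dL0 om1 lossK lossH.
  have lb : 0 <= ln beta := ln_ratio_ge0 y n0 dL0 om1 lossK lossH.
  have ln0n : 0 <= ln n%:R :> R by rewrite ln_ge0// ler1n.
  have lnL : 1 + ln L%:R <= 4 * \sum_(1 <= i < L.+1) ln (d i)%:R :> R.
    by apply: ln_depth_le => // i /andP[_]; exact: d2.
  have ll0 : 0 <= L%:R * logp (logp (beta * Num.sqrt (n%:R / (d L)%:R))).
    by rewrite mulr_ge0// /logp le_max lexx.
  have LamS : Lam <= 2 ^+ 2 * S by rewrite /Lam /S; lra.
  have sq : Num.sqrt Lam <= 2 * Num.sqrt S.
    rewrite -[X in X * _](@ger0_norm R 2)// -sqrtr_sqr -sqrtrM ?sqr_ge0//.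
    exact: ler_wsqrtr.
  have -> : 14 * alpha * Num.sqrt (N%:R / n%:R) * Num.sqrt S =
    7 * (alpha * (Num.sqrt (N%:R / n%:R) * (2 * Num.sqrt S))) by ring.
  by rewrite ler_pM2l// ler_wpM2l// ler_wpM2l ?sqrtr_ge0.
move=> CK CH Cn.
set h := `|CH|; set k := `|CK|; set m := `|Cn|.
have h0 : 0 <= h by exact: normr_ge0.
have k0 : 0 <= k by exact: normr_ge0.
have m0 : 0 <= m by exact: normr_ge0.
pose C' := h ^+ 2 * (4 + m + k) + h + 1.
have C'0 : 0 < C'.
  by rewrite /C' ltr_wpDl// addr_ge0// mulr_ge0 ?sqr_ge0//; lra.
exists (7 * Num.sqrt (2 * C')); first by rewrite mulr_gt0// sqrtr_gt0 mulr_gt0.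
move=> L d omega n Y loss K H y L0 n0 d2 om2 lossK lossH KC HC lnn.
have om1 : forall i, (1 <= i <= L)%N -> 1 <= (fun _ : nat => omega) i.
  by move=> i _; lra.
have dL0 : (0 < (fun _ : nat => d) L)%N by exact: ltnW.
apply: le_trans (sup_rademacher_ReLU_class_le y L0 n0 dL0 om1 lossK lossH) _.
have a0 := class_range_ge0 y n0 dL0 om1 lossK lossH.
have lb := ln_ratio_ge0 y n0 dL0 om1 lossK lossH.
move: a0 lb; rewrite lee_fin /=.
set P := K * _ * _; set alpha := Num.min H P; set beta := alpha^-1 * P.
move=> a0 lb.
set N := num_params _ _; set Lam := 1 + _ + _ + _.
set D := ln (d%:R * L%:R * omega).
have LR : 1 <= L%:R :> R by rewrite ler1n.
have nR : 1 <= n%:R :> R by rewrite ler1n.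
have dR : 2 <= d%:R :> R by rewrite ler_nat.
have ln2 := ln2_ge_half R.
have lnL0 : 0 <= ln L%:R :> R by exact: ln_ge0.
have lnn0 : 0 <= ln n%:R :> R by exact: ln_ge0.
have lnd : ln 2 <= ln d%:R :> R by rewrite ler_ln ?posrE//; lra.
have lnom : ln 2 <= ln omega :> R by rewrite ler_ln ?posrE//; lra.
have lndL : ln (d%:R * L%:R) = ln d%:R + ln L%:R :> R by rewrite lnM ?posrE//; lra.
have DE : D = ln d%:R + ln L%:R + ln omega.
  by rewrite /D lnM ?posrE; [rewrite lndL|apply: mulr_gt0|]; lra.
have D1 : 1 <= D by lra.
have DLD : D <= L%:R * D by rewrite ler_peMl//; lra.
have LLD : L%:R <= L%:R * D by rewrite ler_peMr//; lra.
have aC : alpha <= h.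
  by rewrite (le_trans _ (ler_norm CH))// (le_trans _ HC)// ge_min lexx.
have a2 : alpha ^+ 2 <= h ^+ 2 by rewrite lerXn2r.
have lnL : ln L%:R <= L%:R * D.
  by rewrite (le_trans _ LLD)// ltW// ln_sublinear//; lra.
have lnn' : ln n%:R <= m * (L%:R * D).
  apply: le_trans lnn _; apply: (@le_trans _ _ (m * (L%:R * ln (d%:R * L%:R)))).
    by rewrite ler_wpM2r ?ler_norm// mulr_ge0//; lra.
  by rewrite ler_wpM2l// ler_wpM2l//; lra.
have lnP : 0 < P -> ln P <= (k + 2) * (L%:R * D).
  move=> P0.
  have K0 : 0 < K.
    rewrite lt_neqAle (lipschitz_loss_ge0 (y (Ordinal n0)) dL0 lossK) andbT.
    by apply: contraTneq P0 => Kz; rewrite /P -Kz !mul0r ltxx.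
  have sd : 1 <= Num.sqrt d%:R :> R by rewrite -[leLHS]sqrtr1 ler_wsqrtr//; lra.
  have lnsd : ln (Num.sqrt d%:R) <= ln d%:R :> R.
    rewrite ler_ln ?posrE; [|lra|lra].
    by rewrite -[leRHS]sqr_sqrtr; [nra|lra].
  have -> : P = K * Num.sqrt d%:R * omega ^+ L.
    by rewrite /P prodr_const_nat subn1.
  rewrite lnM ?posrE ?exprn_gt0 ?mulr_gt0//; [|lra|lra].
  rewrite lnM ?posrE//; last lra.
  rewrite lnXn; last lra.
  rewrite -[ln omega *+ L]mulr_natl.
  have lK : ln K <= k * (L%:R * D).
    apply: (@le_trans _ _ k); last by rewrite ler_peMr//; lra.
    by rewrite (le_trans (ltW (ln_sublinear K0)))// (le_trans KC)// ler_norm.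
  have : L%:R * ln omega <= L%:R * D by rewrite ler_wpM2l//; lra.
  lra.
have lnbeta : alpha ^+ 2 * ln beta <= (h ^+ 2 * (k + 2) + h) * (L%:R * D).
  have aP : alpha <= P by rewrite ge_min lexx orbT.
  have M0 : 0 <= (k + 2) * (L%:R * D) by rewrite mulr_ge0//; lra.
  apply: le_trans (sqr_mul_ln_ratio_le a0 aC aP M0 lnP) _.
  by rewrite [leRHS]mulrDl -[h ^+ 2 * (k + 2) * _]mulrA lerD2l ler_peMr//; lra.
have aLam : alpha ^+ 2 * Lam <= C' * (L%:R * D).
  have : alpha ^+ 2 * (1 + ln L%:R + ln n%:R) <= h ^+ 2 * ((2 + m) * (L%:R * D)).
    apply: ler_pM => //; first exact: sqr_ge0; first lra.
    by move: lnn'; lra.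
  move: lnbeta; rewrite /Lam /C'; lra.
have NE : N%:R <= 2 * L%:R * d%:R ^+ 2 :> R.
  rewrite /N /num_params sum_nat_const_nat subn1 /= natrM natrD natrM.
  have : 0 <= L%:R * (d%:R * (d%:R - 1)) :> R by rewrite !mulr_ge0//; lra.
  lra.
have Lam0 : 0 <= Lam by rewrite /Lam; lra.
rewrite -[leRHS]mulrA ler_pM2l// -(@ler_sqr R) ?nnegrE; last 2 first.
- by rewrite !mulr_ge0 ?sqrtr_ge0.
- by rewrite !mulr_ge0 ?invr_ge0 ?sqrtr_ge0.
rewrite !exprMn exprVn !sqr_sqrtr ?divr_ge0//; [|lra|lra].
have -> : alpha ^+ 2 * (N%:R / n%:R * Lam) = (alpha ^+ 2 * Lam) * N%:R / n%:R by ring.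
have -> : 2 * C' * (n%:R^-1 * (d%:R ^+ 2 * L%:R ^+ 2) * D) =
  (C' * (L%:R * D)) * (2 * L%:R * d%:R ^+ 2) / n%:R by ring.
rewrite ler_pM2r ?invr_gt0; last lra.
by apply: ler_pM => //; rewrite mulr_ge0 ?sqr_ge0.
Qed.
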